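(* Let $p$ be an odd prime. Let $\sigma$ and $\delta$ be the permutations of $\mathbb{F}_p$ induced by $x\mapsto x+1$ and $x\mapsto x^{p-2}$ respectively. Let $G$ be the subgroup of the symmetric group on $\mathbb{F}_p$ generated by all permutations $x\mapsto x^d+c$, where $c\in\mathbb{F}_p$ and $d$ ranges over the integers with $1\le d<p-1$ and $\gcd(d,p-1)=1$. Then \[ \langle \sigma,\delta\rangle = G \cong \begin{cases} S_p & \text{if } p\equiv 1 \pmod 4,\\ A_p & \text{if } p\equiv 3 \pmod 4, \end{cases} \] where $S_p$ and $A_p$ denote the symmetric and alternating groups on the $p$ elements of $\mathbb{F}_p$.
   Context: For $\gcd(d,p-1)=1$ the map $x\mapsto x^d+c$ is a bijection of $\mathbb{F}_p$. Groups of permutations are taken with composition of functions. *)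

(* Defs.v *)
From mathcomp Require Import all_boot all_fingroup all_algebra all_solvable all_field.

Set Implicit Arguments.
Unset Strict Implicit.
Unset Printing Implicit Defensive.

Import GRing.Theory.
Local Open Scope ring_scope.

Lemma expD_inj (p d : nat) (c : 'F_p) :
  prime p -> (0 < d)%N -> coprime d p.-1 ->
  injective (fun x : 'F_p => x ^+ d + c).
Proof.
move=> p_pr d_gt0 cop x y /addIr eq_xy.
have expK (k : nat) (z : 'F_p) : z ^+ (k * p.-1).+1 = z.
  have zp : z ^+ p = z by rewrite -{2}(expf_card z) card_Fp.
  elim: k => [|k IHk]; first by rewrite mul0n expr1.
  rewrite mulSn -addnS exprD IHk -{2}[z]expr1 -exprD addn1.
  by rewrite (prednK (prime_gt0 p_pr)) zp.
case: (egcdnP p.-1 d_gt0) => u v; rewrite (eqP cop) addn1 => Euv _.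
by rewrite -(expK v x) -(expK v y) -Euv mulnC !exprM eq_xy.
Qed.

Lemma exp_subn2_inj (p : nat) :
  prime p -> odd p -> injective (fun x : 'F_p => x ^+ (p - 2)).
Proof.
move=> p_pr p_odd x y /= eq_xy.
have p_gt2 : (2 < p)%N by rewrite odd_prime_gt2.
apply: (@expD_inj p (p - 2) 0) => //; last by rewrite /= eq_xy.
- by rewrite subn_gt0.
- case: p p_gt2 {p_pr p_odd x y eq_xy} => [|[|n]] // _.
  by rewrite subSS subSS subn0; exact: coprimenS.
Qed.

Definition sigma (p : nat) : {perm 'F_p} :=
  @perm 'F_p (fun x => x + 1) (addIr 1).

Definition delta (p : nat) (p_pr : prime p) (p_odd : odd p) : {perm 'F_p} :=
  perm (exp_subn2_inj p_pr p_odd).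

(* The exponent ranges over 0 < d < p - 1, the upper bound being that of 'I_p.-1.
   For p prime, by expD_inj, every such d coprime to p - 1 and every c do
   contribute a permutation (see mem_power_translations). *)
Definition power_translations (p : nat) : {set {perm 'F_p}} :=
  [set s : {perm 'F_p} |
    [exists d : 'I_p.-1, exists c : 'F_p,
      [&& (0 < d)%N, coprime d p.-1 & [forall x, s x == x ^+ d + c]]]].

Lemma mem_power_translations (p d : nat) (c : 'F_p) (p_pr : prime p)
    (d_gt0 : (0 < d)%N) (cop : coprime d p.-1) :
  (d < p.-1)%N -> perm (expD_inj (c := c) p_pr d_gt0 cop) \in power_translations p.
Proof.
move=> d_lt; rewrite inE; apply/existsP; exists (Ordinal d_lt).
apply/existsP; exists c; rewrite d_gt0 cop /=.
by apply/forallP=> x; rewrite permE.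
Qed.

Definition power_group (p : nat) : {group {perm 'F_p}} :=
  <<power_translations p>>%G.

(* Main.v *)
Require Import Defs.
From mathcomp Require Import all_boot all_fingroup all_algebra all_solvable all_field.

(** Let [H] be the group generated by sigma and delta, [n] the negation and [t]
    the transposition exchanging 0 and 1. The word [x |-> -x] of the projective
    line in [x+1] and [1/x] becomes [n * t] in [H]; since [n] normalizes [H], so
    does [t]. As [t] and the [p]-cycle sigma generate the symmetric group, that
    group is [H <[t]>], so [H] has index at most 2 and contains all squares.
    If [p = 1 mod 4], then [n] is the square of the multiplication by a square
    root of -1, so [n], hence [t], is in [H]. If [p = 3 mod 4], then [n] exchanges
    nonzero squares and nonsquares and commutes with [x |-> x^d], which is thus
    the product of two conjugate permutations, hence even. *)

Set Implicit Arguments.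
Unset Strict Implicit.
Unset Printing Implicit Defensive.

Import GRing.Theory.

Local Open Scope ring_scope.

Lemma Fp_expf_pred (p : nat) (x : 'F_p) : prime p -> x != 0 -> x ^+ p.-1 = 1.
Proof.
move=> p_pr x_neq0; apply: (mulfI x_neq0).
by rewrite -exprS (prednK (prime_gt0 p_pr)) mulr1 -{2}(expf_card x) card_Fp.
Qed.

Lemma deltaE (p : nat) (p_pr : prime p) (p_odd : odd p) (x : 'F_p) :
  delta p_pr p_odd x = x^-1.
Proof.
have p_gt2 : (2 < p)%N by rewrite odd_prime_gt2.
rewrite permE; have [->|x_neq0] := eqVneq x 0.
  (* Both sides vanish at 0: [0^-1 = 0] by convention, and [p - 2] is positive. *)
  by rewrite invr0 expr0n -leqn0 leqNgt subn_gt0 p_gt2.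
apply: (mulfI x_neq0); rewrite -exprS divff //.
by rewrite -subSn ?(ltnW p_gt2) // subSS subn1 Fp_expf_pred.
Qed.

Definition opp_perm (p : nat) : {perm 'F_p} := perm (@oppr_inj 'F_p).

Section TwoGenerators.

Variables (p : nat) (p_pr : prime p) (p_odd : odd p).

Let H : {group {perm 'F_p}} := <<[set sigma p; delta p_pr p_odd]>>%G.
Let n : {perm 'F_p} := opp_perm p.
Let t : {perm 'F_p} := tperm 0 1.

Let sigma_in : sigma p \in H.
Proof. by rewrite mem_gen // !inE eqxx. Qed.

Let delta_in : delta p_pr p_odd \in H.
Proof. by rewrite mem_gen // !inE eqxx orbT. Qed.

Lemma sigma_order : #[sigma p]%g = p.
Proof.
have sigmaX k x : (sigma p ^+ k)%g x = x + k%:R.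
  elim: k => [|k IHk]; first by rewrite perm1 addr0.
  by rewrite expgSr permM IHk permE -addrA -natr1.
apply: nt_prime_order => //.
  by apply/permP=> x; rewrite sigmaX perm1 pchar_Fp_0 // addr0.
apply: contra_neq (oner_neq0 'F_p) => /permP/(_ 0).
by rewrite permE perm1 add0r.
Qed.

(* On the projective line [x |-> 1/x] and [x |-> x+1] combine to [x |-> -x];
   as delta fixes 0 instead of sending it to infinity, the images of 0 and -1
   are swapped. *)
Lemma sigma_delta_word :
  (sigma p * delta p_pr p_odd * (sigma p)^-1 * delta p_pr p_odd
     * sigma p * delta p_pr p_odd = n * t)%g.
Proof.
have sigmaVE x : (sigma p)^-1%g x = x - 1.
  by apply: (canLR (permK _)); rewrite permE subrK.
apply/permP=> x; rewrite !permM sigmaVE !deltaE ![sigma p _]permE [n x]permE.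
have [->|x_neq0] := eqVneq x 0.
  by rewrite add0r invr1 subrr invr0 add0r invr1 oppr0 tpermL.
have [->|x_neqN1] := eqVneq x (-1).
  by rewrite addNr invr0 add0r invrN1 addNr invr0 opprK tpermR.
have x1_neq0 : x + 1 != 0 by rewrite addr_eq0.
have nx_neq0 : 0 != - x by rewrite eq_sym oppr_eq0.
have nx_neq1 : 1 != - x by rewrite eq_sym eqr_oppLR.
rewrite tpermD //.
have -> : (x + 1)^-1 - 1 = - x / (x + 1).
  apply: (mulIf x1_neq0); rewrite mulrBl mulVf // divfK // mul1r.
  by rewrite opprD addrCA subrr addr0.
rewrite invf_div invrN mulrN mulrDl mul1r divff // opprD addrAC addNr add0r.
by rewrite invrN invrK.
Qed.

(** Conjugation by negation inverts [sigma] and fixes [delta], inversion being an odd function. *)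
Lemma opp_perm_norm : n \in 'N(H)%g.
Proof.
have nE x : n x = - x by rewrite permE.
rewrite inE -genJ gen_subG; apply/subsetP=> _ /imsetP[h + ->].
rewrite !inE => /orP[] /eqP->.
  have -> : (sigma p ^ n = (sigma p)^-1)%g; last by rewrite groupV.
  apply/eqP; rewrite eq_mulgV1 invgK; apply/eqP/permP=> x.
  by rewrite -[x]opprK -nE permM permJ perm1 !permE opprD subrK.
have -> : (delta p_pr p_odd ^ n = delta p_pr p_odd)%g; last exact: delta_in.
by apply/permP=> x; rewrite -[x]opprK -nE permJ !nE !deltaE !invrN.
Qed.

Lemma opp_perm_tperm_mem : (n * t)%g \in H.
Proof. by rewrite -sigma_delta_word !groupM ?groupV. Qed.

Lemma tperm01_norm : t \in 'N(H)%g.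
Proof.
rewrite -(mulKg n t) groupM ?groupV ?opp_perm_norm //.
exact: (subsetP (normG H)) opp_perm_tperm_mem.
Qed.

(** Index at most 2, in elementwise form: [t] is an involution normalizing [H], so the join of [H]
    and [<[t]>] is the union of [H] and [H t]. *)
Lemma mem_or_mul_tperm_mem s : (s \in H) || ((s * t)%g \in H).
Proof.
have p_card : #|'F_p| = p by rewrite card_Fp.
have join_setT : (H <*> <[t]>)%g = [set: {perm 'F_p}].
  apply/eqP; rewrite eqEsubset subsetT -[[set: {perm 'F_p}]]/('Sym_('F_p))%g.
  rewrite -(@gen_tperm_circular_shift _ (0 : 'F_p) 1 (sigma p)).
  - rewrite gen_subG subUset !sub1set.
    rewrite (subsetP (joing_subr _ _)) ?cycle_id //.
    by rewrite (subsetP (joing_subl _ _)).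
  - by rewrite p_card.
  - by rewrite eq_sym oner_eq0.
  - by rewrite p_card sigma_order.
have : s \in (H <*> <[t]>)%g by rewrite join_setT inE.
rewrite norm_joinEr ?cycle_subG ?tperm01_norm //.
case/mulsgP=> h _ hH /cycleP[k ->] ->.
rewrite -(odd_double_half k) expgD -mul2n expgM expgS expg1 tperm2 expg1n mulg1.
by case: (odd k); rewrite ?expg1 ?expg0 ?mulg1 -?mulgA ?tperm2 ?mulg1 hH ?orbT.
Qed.

(** If [s * t] is in [H], so is its conjugate by [t], and the product of the two is [s * s]. *)
Lemma sqr_perm_mem s : (s * s)%g \in H.
Proof.
have /orP[sH|stH] := mem_or_mul_tperm_mem s; first exact: groupM.
have -> : (s * s = (s * t) * (s * t) ^ t)%g.
  by rewrite conjgE !mulgA mulgK -{2}[t]tpermV mulgK.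
by rewrite groupM // memJ_norm ?tperm01_norm.
Qed.

End TwoGenerators.

(** For a primitive root [z], the element [z ^+ ((p - 1) / 4)] has order 4, so its square is a
    square root of 1 other than 1. *)
Lemma Fp_sqrtN1 (p : nat) :
  prime p -> p = 1 %[mod 4] -> exists i : 'F_p, i ^+ 2 = -1.
Proof.
move=> p_pr p_mod4.
have p_gt1 := prime_gt1 p_pr.
have [k Dp] : exists k, p.-1 = (k * 4)%N.
  by exists (p %/ 4)%N; rewrite {1}(divn_eq p 4) p_mod4 addn1.
have k_gt0 : (0 < k)%N.
  by case: k Dp => // Dp; move: p_gt1; rewrite -ltn_predRL Dp.
have pred_p_gt0 : (0 < p.-1)%N by rewrite ltn_predRL.
have : has p.-1.-primitive_root (enum [pred x : 'F_p | x != 0]).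
  apply: has_prim_root; rewrite ?enum_uniq //.
    by apply/allP=> x; rewrite mem_enum unity_rootE => /Fp_expf_pred->.
  have := cardC1 (0 : 'F_p); rewrite card_Fp // => <-.
  by rewrite -cardE; apply: subset_leq_card; apply/subsetP=> x.
case/hasP=> z _ z_prim; exists (z ^+ k).
have : (z ^+ k) ^+ 2 != 1.
  by rewrite -exprM -(prim_order_dvd z_prim) Dp dvdn_pmul2l.
have : ((z ^+ k) ^+ 2) ^+ 2 == 1 ^+ 2.
  by rewrite -!exprM -[(k * (2 * 2))%N]/(k * 4)%N -Dp (prim_expr_order z_prim) expr1n.
by rewrite eqf_sqr => /orP[/eqP->|/eqP-> //]; rewrite eqxx.
Qed.

Lemma even_power_perm (p d : nat) (s : {perm 'F_p}) :
  prime p -> p = 3 %[mod 4] -> odd d -> (forall x, s x = x ^+ d) ->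
  ~~ odd_perm s.
Proof.
move=> p_pr p_mod4 d_odd sE.
(* This is [(p - 1) / 2], visibly odd. By Euler's criterion, [x ^+ m == 1] singles out the nonzero
   squares. *)
pose m := (p %/ 4).*2.+1%N.
have m2 : p.-1 = (m * 2)%N.
  by rewrite {1}(divn_eq p 4) p_mod4 addn3 /m mulSn -muln2 -mulnA.
have p_gt2 : (2 < p)%N.
  by rewrite odd_prime_gt2 // -(odd_mod (d := 4) p) // p_mod4.
have N1_neq1 : -1 != 1 :> 'F_p.
  rewrite -subr_eq0 -opprD oppr_eq0 -(natrD _ 1 1) -(dvdn_pcharf (pchar_Fp p_pr)).
  by rewrite gtnNdvd.
have exprN_odd k (x : 'F_p) : odd k -> (- x) ^+ k = - x ^+ k.
  by move=> k_odd; rewrite exprNn -signr_odd k_odd mulN1r.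
have sq_or_Nsq (x : 'F_p) : x != 0 -> (x ^+ m == 1) || ((- x) ^+ m == 1).
  move=> /(Fp_expf_pred p_pr)/eqP; rewrite m2 exprM -[1](expr1n _ 2) eqf_sqr.
  by rewrite exprN_odd /= ?odd_double // eqr_oppLR.
have sq_Nsq (x : 'F_p) : x ^+ m == 1 -> (- x) ^+ m == 1 = false.
  by rewrite exprN_odd /= ?odd_double // => /eqP->; apply: negPf.
have sqX (x : 'F_p) : x ^+ m == 1 -> (x ^+ d) ^+ m == 1.
  by rewrite exprAC => /eqP->; rewrite expr1n.
(* The power map on nonzero squares, the identity elsewhere. Its conjugate by negation is the power
   map on nonsquares, as [d] is odd. *)
pose a (x : 'F_p) := if x ^+ m == 1 then x ^+ d else x.
have a_inj : injective a.
  move=> x y; rewrite /a.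
  case: ifP => [x_sq|x_nsq]; case: ifP => [y_sq|y_nsq] // Exy.
  - by apply: (@perm_inj _ s); rewrite !sE.
  - by rewrite -Exy sqX in y_nsq.
  - by rewrite Exy sqX in x_nsq.
suff -> : s = (perm a_inj * perm a_inj ^ opp_perm p)%g.
  by rewrite odd_permM odd_permJ addbb.
have aJ x : (perm a_inj ^ opp_perm p)%g x = - a (- x).
  have {1}-> : x = opp_perm p (- x) by rewrite permE opprK.
  by rewrite permJ !permE.
have expd0 : 0 ^+ d = 0 :> 'F_p.
  by rewrite expr0n; case: d d_odd {sE sqX a a_inj aJ}.
apply/permP=> x; rewrite permM aJ sE permE /a.
have [->|/sq_or_Nsq/orP[x_sq|Nx_sq]] := eqVneq x 0.
- by rewrite expd0 if_same oppr0 expd0 if_same oppr0.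
- by rewrite x_sq sq_Nsq ?sqX // opprK.
- have := sq_Nsq _ Nx_sq; rewrite opprK => ->.
  by rewrite Nx_sq exprN_odd // opprK.
Qed.

(** Translation by [c] is the square of translation by [c / 2], hence even. This leaves the pure
    power [x ^+ d], where [d] is odd, being coprime to the even number [p - 1]. *)
Lemma power_group_even (p : nat) :
  prime p -> p = 3 %[mod 4] -> power_group p \subset ('Alt_('F_p))%g.
Proof.
move=> p_pr p_mod4; rewrite gen_subG; apply/subsetP=> s.
rewrite inE => /existsP[d /existsP[c /and3P[d_gt0 d_cop /forallP sE]]].
have p_odd : odd p by rewrite -(odd_mod (d := 4) p) ?p_mod4.
have d_odd : odd d.
  rewrite -coprimen2; apply: coprime_dvdr d_cop.
  by rewrite dvdn2 -subn1 oddB ?prime_gt0 ?p_odd.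
pose s0 := perm (expD_inj (c := 0) p_pr d_gt0 d_cop).
pose u := perm (@addIr 'F_p (c / 2%:R)).
have two_neq0 : 2%:R != 0 :> 'F_p.
  by rewrite -(dvdn_pcharf (pchar_Fp p_pr)) gtnNdvd // odd_prime_gt2.
have -> : s = (s0 * (u * u))%g.
  apply/permP=> x; rewrite !permM (eqP (sE x)) !permE addr0 -addrA.
  by rewrite -[in LHS](divfK two_neq0 c) mulr_natr mulr2n.
rewrite Alt_even !odd_permM addbb addbF.
by apply: (@even_power_perm p d) => // x; rewrite permE addr0.
Qed.

Theorem theorem1p1 (p : nat) (p_pr : prime p) (p_odd : odd p) :
  (<<[set sigma p; delta p_pr p_odd]>> = power_group p :> {set {perm 'F_p}} /\
   (p = 1 %[mod 4] -> power_group p \isog 'Sym_('F_p)) /\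
   (p = 3 %[mod 4] -> power_group p \isog 'Alt_('F_p)))%g.
Proof.
have p_gt2 : (2 < p)%N by rewrite odd_prime_gt2.
set H := <<_>>%g.
have HG : H \subset power_group p.
  rewrite gen_subG subUset !sub1set.
  have d_gt0 : (0 < p - 2)%N by rewrite subn_gt0.
  have lt1 : (1 < p.-1)%N by rewrite ltn_predRL.
  apply/andP; split; apply: mem_gen; rewrite inE.
    (* [sigma] is the case [d = 1], [c = 1]; below, [delta] is the case [d = p - 2], [c = 0]. *)
    apply/existsP; exists (Ordinal lt1); apply/existsP; exists 1.
    by rewrite /= coprime1n; apply/forallP=> x; rewrite permE.
  have Dp1 : (p - 2).+1 = p.-1 by rewrite -subSn ?(ltnW p_gt2) // subSS subn1.
  have lt2 : (p - 2 < p.-1)%N by rewrite -Dp1.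
  have cop2 : coprime (p - 2) p.-1 by rewrite -Dp1 coprimenS.
  apply/existsP; exists (Ordinal lt2); apply/existsP; exists 0.
  rewrite /= d_gt0 cop2 /=.
  by apply/forallP=> x; rewrite permE addr0.
have [p1|p3] : p = 1 %[mod 4] \/ p = 3 %[mod 4].
- move: (ltn_pmod p (isT : (0 < 4)%N)) (p_odd).
  by rewrite -(odd_mod (d := 4) p) //; case: (p %% 4)%N => [|[|[|[|]]]] //; auto.
- have [i i2] := Fp_sqrtN1 p_pr p1.
  have i_neq0 : i != 0.
    by apply: contra_eq_neq i2 => ->; rewrite expr0n eq_sym oppr_eq0 oner_eq0.
  have nH : opp_perm p \in H.
    have -> : opp_perm p = (perm (mulIf i_neq0) * perm (mulIf i_neq0))%g.
      by apply/permP=> x; rewrite permM !permE -mulrA -expr2 i2 mulrN1.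
    exact: sqr_perm_mem.
  have tH : tperm 0 1 \in H.
    by rewrite -(groupMl _ nH) opp_perm_tperm_mem.
  have HT : H = ('Sym_('F_p))%g.
    apply/eqP; rewrite eqEsubset subsetT; apply/subsetP=> s _.
    by have /orP[//|] := mem_or_mul_tperm_mem p_pr p_odd s; rewrite groupMr.
  have GT : power_group p = ('Sym_('F_p))%G.
    by apply/val_inj/eqP; rewrite /= eqEsubset subsetT -HT.
  rewrite GT; split=> //; split=> [_|]; first exact: isog_refl.
  by rewrite p1.
- have GA := power_group_even p_pr p3.
  have AH : ('Alt_('F_p))%g \subset H.
    apply/subsetP=> s; rewrite Alt_even => s_even.
    (* For even [s], the odd permutation [s * t] cannot lie in [H], as [H] is contained in the
       alternating group. *)
    have /orP[//|/(subsetP HG)/(subsetP GA)] := mem_or_mul_tperm_mem p_pr p_odd s.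
    rewrite Alt_even odd_permM odd_tperm eq_sym oner_neq0.
    by rewrite addbT negbK (negPf s_even).
  have GT : power_group p = ('Alt_('F_p))%G.
    by apply/val_inj/eqP; rewrite /= eqEsubset GA (subset_trans AH).
  rewrite GT; split; first by apply/eqP; rewrite eqEsubset AH -GT HG.
  by split=> [|_]; [rewrite p3 | exact: isog_refl].
Qed.
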